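(* Let $t=[t_0:t_1]\in\mathbb{P}^1$ with $t\notin\{1,\infty\}$ (that is, $t_0\ne t_1$ and $t_1\neq0$). Then the spinor map $\rho:C_{\mathrm{nod},t}^{\mathrm{sm}}\to\mathbb{P}(S^{+})=\mathbb{P}^{15}$ extends to an embedding of $C_{\mathrm{nod},t}$, and $$\rho(C_{\mathrm{nod},t})=P_{\mathrm{nod},t}\cap\operatorname{OG}(5,10),$$ where $P_{\mathrm{nod},t}=\mathbb{P}(L_t)$ and $L_t\subset S^{+}$ is the 7-dimensional subspace spanned by $$e_{12}+e_{13},\quad e_{24},\quad e_{34},\quad (t_0t_1-t_1^2)\cdot1+(t_0-t_1)e_{15}+t_1e_{23}+t_1e_{25}+t_0e_{35},\quad e_{23}+e_{25}+e_{45},\quad e_{1235},\quad e_{1345}.$$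
   Context: Work over $\mathbb{C}$. Fix a representative $(t_0,t_1)$ of $t=[t_0:t_1]$; the same representative is used in all formulas. The curve. $C_{\mathrm{nod},t}\subset\mathbb{P}^6$ is the reducible nodal curve defined by the ideal $I_t$ generated by $y_2y_6$, $y_1y_6$, $y_3y_5-y_4y_5+y_4y_6$, $y_1y_5$, $y_0y_5$, $y_0y_4-y_2y_4+y_3y_4-y_4y_5+y_4y_6$, $t_0y_2y_3-t_1y_2y_4+(-t_0+t_1)y_3y_4+(t_0-t_1)y_4y_5+(-t_0+t_1)y_4y_6$, $y_1y_3-y_2y_3+y_3y_4-y_4y_5+y_4y_6$, $y_0y_3-y_2y_3+y_3^2-y_4y_5+y_3y_6+y_4y_6$, $y_0y_2-y_1y_2+y_2y_3-y_2y_4$. Its smooth locus is $C_{\mathrm{nod},t}^{\mathrm{sm}}$. Use the following basis of the space of quadrics in $I_t$, which satisfies $\sum_{i=0}^4g_ig_{i+5}=0$: $g_0=-t_0y_1y_3+t_1y_0y_4$; $g_1=-(t_0-t_1)y_0y_3-t_1y_2y_3-(t_0-t_1)y_3^2+t_1y_2y_4+(t_0-t_1)y_3y_4-(t_0-t_1)y_3y_6$; $g_2=(t_0-t_1)y_1y_3+t_1y_2y_3-t_1y_2y_4$; $g_3=t_0y_2y_3-t_1y_2y_4-(t_0-t_1)y_3y_4+(t_0-t_1)y_3y_5$; $g_4=-t_1y_0y_2+t_1y_1y_2-t_1y_2y_3+t_1y_2y_4$; $g_5=y_2y_6$; $g_6=y_1y_5$; $g_7=y_0y_5+y_3y_5-y_4y_5+y_4y_6$;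 $g_8=y_1y_6$; $g_9=y_3y_5-y_4y_5+y_4y_6$. Spinors. Let $V=\mathbb{C}^{10}$ with basis $e_{-1},\dots,e_{-5},e_1,\dots,e_5$, where $e_{-i}$ corresponds to index $i-1$ and $e_i$ to index $i+4$ in $\{0,\dots,9\}$, with quadratic form $Q=\sum_{i=1}^5z_{-i}z_i$. Let $U_\infty=\operatorname{Span}(e_1,\dots,e_5)$ and $S^{+}=\bigwedge^{\mathrm{even}}U_\infty$, with basis $e_I=e_{i_1}\wedge\cdots\wedge e_{i_k}$ ($I=\{i_1<\cdots<i_k\}\subset\{1,\dots,5\}$, $k$ even; $1=e_\emptyset$) and coordinates $x_I$ ($x_0=x_\emptyset$). Each $v\in V$ gives an endomorphism $\varphi_v$ of $\bigwedge U_\infty$, linear in $v$: $\varphi_{e_i}$ is left wedging by $e_i$ and $\varphi_{e_{-i}}$ is contraction against $e_i$. A Lagrangian (5-dimensional totally isotropic subspace) $U\subset V$ with $\dim(U\cap U_\infty)$ even has a half spinor $s_U\in S^{+}$, unique up to scalar, characterized by $s_U\neq0$ and $\varphi_u(s_U)=0$ for all $u\in U$. For a smooth point $p$ let $W_p^\perp\subset V$ be the Lagrangian spanned by the rows $\left(\frac{\partial g_0}{\partial y_i}(p),\dots,\frac{\partial g_9}{\partial y_i}(p)\right)$, $i=0,\dots,6$, and set $\rho(p)=[s_{W_p^\perp}]\in\mathbb{P}(S^{+})$. $\operatorname{OG}(5,10)\subset\mathbb{P}(S^{+})$ is the orthogonal Grassmannian, the subscheme defined by $x_0x_{2345}-x_{23}x_{45}+x_{24}x_{35}-x_{25}x_{34}$,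 $x_{12}x_{1345}-x_{13}x_{1245}+x_{14}x_{1235}-x_{15}x_{1234}$, $x_0x_{1345}-x_{13}x_{45}+x_{14}x_{35}-x_{15}x_{34}$, $x_{12}x_{2345}-x_{23}x_{1245}+x_{24}x_{1235}-x_{25}x_{1234}$, $x_0x_{1245}-x_{12}x_{45}+x_{14}x_{25}-x_{15}x_{24}$, $x_{13}x_{2345}-x_{23}x_{1345}+x_{34}x_{1235}-x_{35}x_{1234}$, $x_0x_{1235}-x_{12}x_{35}+x_{13}x_{25}-x_{15}x_{23}$, $x_{14}x_{2345}-x_{24}x_{1345}+x_{34}x_{1245}-x_{45}x_{1234}$, $x_0x_{1234}-x_{12}x_{34}+x_{13}x_{24}-x_{14}x_{23}$, $x_{15}x_{2345}-x_{25}x_{1345}+x_{35}x_{1245}-x_{45}x_{1235}$. *)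

(* Defs.v *)
From HB Require Import structures.
From mathcomp Require Import all_boot all_order all_algebra.
From mathcomp Require Import reals.
From mathcomp Require Import complex.
From mathcomp Require Import mpoly.

Set Implicit Arguments.
Unset Strict Implicit.
Unset Printing Implicit Defensive.

Import Order.TTheory GRing.Theory Num.Theory.
Local Open Scope ring_scope.

(* Closed subschemes of projective space and their morphisms, in homogeneous
   coordinates.  A closed subscheme of P^(n-1) is given by a set X of forms in n
   variables, and is Proj (K[x]/(X)).  K is meant to be algebraically closed, so
   that conditions on open covers can be tested on K-points. *)
Section ProjectiveSchemes.
Variable K : fieldType.

Definition generators (n : nat) := {mpoly K[n]} -> Prop.

Definition homogeneous n (X : generators n) :=
  forall p, X p -> exists d, p \is d.-homog.

Definition in_ideal n (X : generators n) (p : {mpoly K[n]}) :=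
  exists2 s : seq ({mpoly K[n]} * {mpoly K[n]}),
    (forall cg, cg \in s -> X cg.2) & p = \sum_(cg <- s) cg.1 * cg.2.

Definition intersection n (X Y : generators n) : generators n :=
  fun p => X p \/ Y p.

Definition nonzero n (p : 'I_n -> K) := exists i, p i != 0.

Definition on n (X : generators n) (p : 'I_n -> K) :=
  nonzero p /\ forall g, X g -> g.@[p] = 0.

(* The section of a twist of the structure sheaf defined by the form p is zero on
   the open subscheme where the form h does not vanish.  That open set is covered
   by the D_+(h 'X_k); the factors 'X_k matter when h has degree 0: zero_on X 1 p
   says that p lies in the saturation of the ideal of X. *)
Definition zero_on n (X : generators n) (h p : {mpoly K[n]}) :=
  forall k, exists N, in_ideal X ((h * 'X_k) ^+ N * p).

(* A tuple of m forms of one degree is a map to P^(m-1) on the open set where the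
   forms do not all vanish. *)
Definition form_tuple n m (F : m.-tuple {mpoly K[n]}) :=
  exists d, forall i, tnth F i \is d.-homog.

Definition value n m (F : m.-tuple {mpoly K[n]}) (p : 'I_n -> K) : 'I_m -> K :=
  fun i => (tnth F i).@[p].

(* F and G define the same map where both are defined. *)
Definition agree n m (X : generators n) (F G : m.-tuple {mpoly K[n]}) :=
  forall k l i j,
    zero_on X (tnth F k * tnth G l)
      (tnth F i * tnth G j - tnth F j * tnth G i).

(* Every morphism X -> P^(m-1) is obtained by gluing finitely many tuples of
   forms: a tuple representing it on D_+(h), multiplied by h, is defined only
   inside D_+(h). *)
Definition is_morphism n m (X : generators n) (f : seq (m.-tuple {mpoly K[n]})) :=
  [/\ forall F, F \in f -> form_tuple F,
      forall p, on X p -> exists2 F, F \in f & nonzero (value F p)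
    & forall F G, F \in f -> G \in f -> agree X F G].

(* The form q pulls back to the zero section along f. *)
Definition pullback_zero n m (X : generators n)
    (f : seq (m.-tuple {mpoly K[n]})) (q : {mpoly K[m]}) :=
  forall F, F \in f -> forall k, zero_on X (tnth F k) (q \mPo F).

Definition factors_through n m (X : generators n)
    (f : seq (m.-tuple {mpoly K[n]})) (Z : generators m) :=
  forall q, Z q -> pullback_zero X f q.

Definition same_morphism n m (X : generators n)
    (f g : seq (m.-tuple {mpoly K[n]})) :=
  forall F G, F \in f -> G \in g -> agree X F G.

Definition id_morphism n : seq (n.-tuple {mpoly K[n]}) :=
  [:: [tuple 'X_i | i < n]].

Definition comp_morphism n m l (g : seq (l.-tuple {mpoly K[m]}))
    (f : seq (m.-tuple {mpoly K[n]})) : seq (l.-tuple {mpoly K[n]}) :=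
  [seq [tuple tnth G i \mPo F | i < l] | G <- g, F <- f].

Definition isomorphism_onto n m (X : generators n)
    (f : seq (m.-tuple {mpoly K[n]})) (Z : generators m) :=
  [/\ is_morphism X f, factors_through X f Z &
      exists g : seq (n.-tuple {mpoly K[m]}),
        [/\ is_morphism Z g, factors_through Z g X,
            same_morphism X (comp_morphism g f) (id_morphism n)
          & same_morphism Z (comp_morphism f g) (id_morphism m)]].

Definition closed_embedding n m (X : generators n)
    (f : seq (m.-tuple {mpoly K[n]})) :=
  exists2 Z : generators m, homogeneous Z & isomorphism_onto X f Z.

(* The ideal sheaf of Z is the kernel of O_(P^(m-1)) -> f_* O_X. *)
Definition scheme_image n m (X : generators n)
    (f : seq (m.-tuple {mpoly K[n]})) (Z : generators m) :=
  forall d (q : {mpoly K[m]}), q \is d.-homog ->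
    pullback_zero X f q <-> zero_on Z 1 q.

End ProjectiveSchemes.

Section Spinors.
Variable K : fieldType.

(* V = K^10: e_(-i) is the coordinate lshift 5 (i-1) (index i-1), and e_i is
   rshift 5 (i-1) (index i+4). *)
Definition quadform (z : 'rV[K]_(5 + 5)) : K :=
  \sum_(i < 5) z 0 (lshift 5 i) * z 0 (rshift 5 i).

Definition lagrangian m (U : 'M[K]_(m, 5 + 5)) :=
  \rank U = 5%N /\ forall u : 'rV_(5 + 5), (u <= U)%MS -> quadform u = 0.

(* The exterior algebra of U_oo, in coordinates on the basis e_I; the element
   i : 'I_5 stands for the index i + 1. *)
Definition exterior := {ffun {set 'I_5} -> K}.

Definition sgn (i : 'I_5) (I : {set 'I_5}) : K :=
  (-1) ^+ #|[set j in I | (j < i)%N]|.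

Definition wedge (i : 'I_5) (s : exterior) : exterior :=
  [ffun I : {set 'I_5} => if i \in I then sgn i I * s (I :\ i) else 0].

Definition contract (i : 'I_5) (s : exterior) : exterior :=
  [ffun I : {set 'I_5} => if i \in I then 0 else sgn i I * s (i |: I)].

Definition phi (v : 'rV[K]_(5 + 5)) (s : exterior) : exterior :=
  [ffun I : {set 'I_5} => \sum_(i < 5) (v 0 (lshift 5 i) * contract i s I
                           + v 0 (rshift 5 i) * wedge i s I)].

Definition even_part (s : exterior) := forall I : {set 'I_5}, odd #|I| -> s I = 0.

(* s represents the half spinor [s_U] of the Lagrangian row space of U. *)
Definition half_spinor m (U : 'M[K]_(m, 5 + 5)) (s : exterior) :=
  [/\ lagrangian U, even_part s, s != 0
    & forall u : 'rV_(5 + 5), (u <= U)%MS -> phi u s = 0].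

(* The order of the 16 coordinates x_I of S^+. *)
Definition even_sets : seq (seq nat) :=
  [:: [::]; [:: 1; 2]; [:: 1; 3]; [:: 1; 4]; [:: 1; 5]; [:: 2; 3]; [:: 2; 4];
      [:: 2; 5]; [:: 3; 4]; [:: 3; 5]; [:: 4; 5]; [:: 1; 2; 3; 4];
      [:: 1; 2; 3; 5]; [:: 1; 2; 4; 5]; [:: 1; 3; 4; 5]; [:: 2; 3; 4; 5]]%N.

Definition even_idx (I : seq nat) : 'I_16 := inord (index I even_sets).

Definition even_set (k : 'I_16) : {set 'I_5} :=
  [set i : 'I_5 | i.+1 \in nth [::] even_sets k].

Definition spinor_of (x : 'I_16 -> K) : exterior :=
  [ffun I : {set 'I_5} => \sum_(k < 16 | I == even_set k) x k].

Definition xvar (I : seq nat) : {mpoly K[16]} := 'X_(even_idx I).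
Local Notation "x_[ i ; .. ; j ]" := (xvar (i%N :: .. [:: j%N] ..)).

Definition evec (I : seq nat) : 'rV[K]_16 := delta_mx 0 (even_idx I).

Definition OG : generators K 16 :=
  fun q => q \in
  [:: xvar [::] * x_[2; 3; 4; 5] - x_[2; 3] * x_[4; 5]
        + x_[2; 4] * x_[3; 5] - x_[2; 5] * x_[3; 4];
      x_[1; 2] * x_[1; 3; 4; 5] - x_[1; 3] * x_[1; 2; 4; 5]
        + x_[1; 4] * x_[1; 2; 3; 5] - x_[1; 5] * x_[1; 2; 3; 4];
      xvar [::] * x_[1; 3; 4; 5] - x_[1; 3] * x_[4; 5]
        + x_[1; 4] * x_[3; 5] - x_[1; 5] * x_[3; 4];
      x_[1; 2] * x_[2; 3; 4; 5] - x_[2; 3] * x_[1; 2; 4; 5]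
        + x_[2; 4] * x_[1; 2; 3; 5] - x_[2; 5] * x_[1; 2; 3; 4];
      xvar [::] * x_[1; 2; 4; 5] - x_[1; 2] * x_[4; 5]
        + x_[1; 4] * x_[2; 5] - x_[1; 5] * x_[2; 4];
      x_[1; 3] * x_[2; 3; 4; 5] - x_[2; 3] * x_[1; 3; 4; 5]
        + x_[3; 4] * x_[1; 2; 3; 5] - x_[3; 5] * x_[1; 2; 3; 4];
      xvar [::] * x_[1; 2; 3; 5] - x_[1; 2] * x_[3; 5]
        + x_[1; 3] * x_[2; 5] - x_[1; 5] * x_[2; 3];
      x_[1; 4] * x_[2; 3; 4; 5] - x_[2; 4] * x_[1; 3; 4; 5]
        + x_[3; 4] * x_[1; 2; 4; 5] - x_[4; 5] * x_[1; 2; 3; 4];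
      xvar [::] * x_[1; 2; 3; 4] - x_[1; 2] * x_[3; 4]
        + x_[1; 3] * x_[2; 4] - x_[1; 4] * x_[2; 3];
      x_[1; 5] * x_[2; 3; 4; 5] - x_[2; 5] * x_[1; 3; 4; 5]
        + x_[3; 5] * x_[1; 2; 4; 5] - x_[4; 5] * x_[1; 2; 3; 5]].

(* The projectivization of a row space L: all linear forms vanishing on L. *)
Definition linear_subspace m n (L : 'M[K]_(m, n)) : generators K n :=
  fun q => exists2 a : 'rV[K]_n, L *m a^T = 0 & q = \sum_i (a 0 i)%:MP * 'X_i.

End Spinors.

Arguments OG K _ : clear implicits.

Section Curve.
Variables (K : fieldType) (t0 t1 : K).

Local Notation "e_[ i ; .. ; j ]" := (evec K (i%N :: .. [:: j%N] ..)).

Definition y (k : nat) : {mpoly K[7]} := 'X_(inord k).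

Definition Cnod_eqs : seq {mpoly K[7]} :=
  let a := t0%:MP in let b := t1%:MP in
  [:: y 2 * y 6;
      y 1 * y 6;
      y 3 * y 5 - y 4 * y 5 + y 4 * y 6;
      y 1 * y 5;
      y 0 * y 5;
      y 0 * y 4 - y 2 * y 4 + y 3 * y 4 - y 4 * y 5 + y 4 * y 6;
      a * y 2 * y 3 - b * y 2 * y 4 + (- a + b) * y 3 * y 4
        + (a - b) * y 4 * y 5 + (- a + b) * y 4 * y 6;
      y 1 * y 3 - y 2 * y 3 + y 3 * y 4 - y 4 * y 5 + y 4 * y 6;
      y 0 * y 3 - y 2 * y 3 + y 3 ^+ 2 - y 4 * y 5 + y 3 * y 6 + y 4 * y 6;
      y 0 * y 2 - y 1 * y 2 + y 2 * y 3 - y 2 * y 4].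

Definition Cnod : generators K 7 := fun q => q \in Cnod_eqs.

(* The basis g_0, ..., g_9 of the quadrics in the ideal of Cnod. *)
Definition gquad : seq {mpoly K[7]} :=
  let a := t0%:MP in let b := t1%:MP in
  [:: - a * y 1 * y 3 + b * y 0 * y 4;
      - (a - b) * y 0 * y 3 - b * y 2 * y 3 - (a - b) * y 3 ^+ 2
        + b * y 2 * y 4 + (a - b) * y 3 * y 4 - (a - b) * y 3 * y 6;
      (a - b) * y 1 * y 3 + b * y 2 * y 3 - b * y 2 * y 4;
      a * y 2 * y 3 - b * y 2 * y 4 - (a - b) * y 3 * y 4
        + (a - b) * y 3 * y 5;
      - b * y 0 * y 2 + b * y 1 * y 2 - b * y 2 * y 3 + b * y 2 * y 4;
      y 2 * y 6;
      y 1 * y 5;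
      y 0 * y 5 + y 3 * y 5 - y 4 * y 5 + y 4 * y 6;
      y 1 * y 6;
      y 3 * y 5 - y 4 * y 5 + y 4 * y 6].

(* Jacobian criterion for a point of a curve in P^6: the rank is the
   codimension 5. *)
Definition smooth_point (p : 'I_7 -> K) :=
  on Cnod p /\
  \rank (\matrix_(k < size Cnod_eqs, i < 7) (Cnod_eqs`_k)^`M(i).@[p]) = 5%N.

(* The row space is W_p^perp. *)
Definition Wperp (p : 'I_7 -> K) : 'M[K]_(7, 5 + 5) :=
  \matrix_(i < 7, j < 5 + 5) (gquad`_j)^`M(i).@[p].

(* f(p) = rho(p) at every smooth point p. *)
Definition extends_spinor_map (f : seq (16.-tuple {mpoly K[7]})) :=
  forall p, smooth_point p -> forall F, F \in f -> nonzero (value F p) ->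
    half_spinor (Wperp p) (spinor_of (value F p)).

Definition Lnod : 'M[K]_(7, 16) :=
  \matrix_(k < 7) nth 0
    [:: e_[1; 2] + e_[1; 3];
        e_[2; 4];
        e_[3; 4];
        (t0 * t1 - t1 ^+ 2) *: evec K [::] + (t0 - t1) *: e_[1; 5]
          + t1 *: e_[2; 3] + t1 *: e_[2; 5] + t0 *: e_[3; 5];
        e_[2; 3] + e_[2; 5] + e_[4; 5];
        e_[1; 2; 3; 5];
        e_[1; 3; 4; 5]] k.

End Curve.

(* Main.v *)
Require Import Defs.
From mathcomp Require Import all_boot all_order all_algebra.
From mathcomp Require Import reals.
From mathcomp Require Import complex.
From mathcomp Require Import ring.
From mathcomp Require Import mpoly.

Set Implicit Arguments.
Unset Strict Implicit.
Unset Printing Implicit Defensive.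

Import GRing.Theory.
Local Open Scope ring_scope.

(** The spinor map is given by linear forms F = [spinor_forms].  The equations of
    OG(5,10) are, up to sign, the components q_0, ..., q_9 of the quadratic map
    q : S^+ -> V, and q o F = t1 g; since F parametrizes the linear subspace L_t, the
    nodal curve and P(L_t) /\ OG(5,10) correspond to each other under F and a linear
    left inverse of F.  For the spinor property, polarizing phi_(q(x)) x = 0 at a point
    with q(x) = 0 gives phi_(B(x,z)) x = 0, where B is the polar form of q; by
    q o F = t1 g, the row space of W_p^perp consists of the vectors
    B(F(p), F(w)) / t1. *)

(** * Substitution in polynomials *)

Section MPolyComplements.
Variable K : comNzRingType.

(** Constants and variables generate the polynomial ring. This form of induction suits statements
    about substitutions, which respect sums and products. *)
Lemma mpoly_ringind n (P : {mpoly K[n]} -> Prop) :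
    (forall c, P c%:MP) -> (forall i, P 'X_i) ->
    (forall p q, P p -> P q -> P (p + q)) ->
    (forall p q, P p -> P q -> P (p * q)) ->
  forall p, P p.
Proof.
move=> PC PX PD PM; elim/mpolyind=> [|c m p _ _ Pp]; first by rewrite -mpolyC0.
apply: (PD) Pp; rewrite -mul_mpolyC; apply: (PM) => //.
have P1 : P 1 by rewrite -mpolyC1.
rewrite mpolyXE_id; apply: big_ind => // i _.
by elim: (m i) => [|k IHk]; rewrite ?expr0 // exprS; apply: (PM).
Qed.

Lemma comp_mpolyM n k (F : n.-tuple {mpoly K[k]}) :
  {morph comp_mpoly F : p q / p * q}.
Proof. exact: rmorphM. Qed.

Lemma comp_mpolyXU_tnth n k (F : n.-tuple {mpoly K[k]}) i :
  'X_i \mPo F = tnth F i.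
Proof. by rewrite comp_mpolyXU -tnth_nth. Qed.

Lemma tnth_comp_mpoly n k l (F : k.-tuple {mpoly K[n]}) (G : l.-tuple {mpoly K[k]})
    j :
  tnth [tuple tnth G i \mPo F | i < l] j = tnth G j \mPo F.
Proof. exact: tnth_mktuple. Qed.

Lemma comp_mpolyA n k l (F : n.-tuple {mpoly K[k]}) (G : k.-tuple {mpoly K[l]})
    (p : {mpoly K[n]}) :
  (p \mPo F) \mPo G = p \mPo [tuple tnth F i \mPo G | i < n].
Proof.
elim/mpoly_ringind: p => [c|i|p q IHp IHq|p q IHp IHq].
- by rewrite !comp_mpolyC.
- by rewrite !comp_mpolyXU_tnth tnth_mktuple.
- by rewrite !comp_mpolyD IHp IHq.
- by rewrite !comp_mpolyM IHp IHq.
Qed.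

End MPolyComplements.

(** * Ideals, substitution, and powers that carry a polynomial into an ideal *)

Section Ideals.
Variable K : fieldType.

Lemma in_ideal_gen n (X : generators K n) p : X p -> in_ideal X p.
Proof.
move=> Xp; exists [:: (1, p)]; last by rewrite big_seq1 mul1r.
by move=> cg; rewrite inE => /eqP->.
Qed.

Lemma in_ideal0 n (X : generators K n) : in_ideal X 0.
Proof. by exists [::]; rewrite ?big_nil. Qed.

Lemma in_idealD n (X : generators K n) p q :
  in_ideal X p -> in_ideal X q -> in_ideal X (p + q).
Proof.
move=> [s Xs ->] [r Xr ->]; exists (s ++ r); last by rewrite big_cat.
by move=> cg; rewrite mem_cat => /orP[/Xs|/Xr].
Qed.

Lemma in_idealM n (X : generators K n) c p :
  in_ideal X p -> in_ideal X (c * p).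
Proof.
move=> [s Xs ->]; exists [seq (c * cg.1, cg.2) | cg <- s].
  by move=> _ /mapP[cg /Xs Xcg ->].
by rewrite big_map mulr_sumr; apply: eq_bigr => cg _; rewrite mulrA.
Qed.

Lemma in_idealN n (X : generators K n) p : in_ideal X p -> in_ideal X (- p).
Proof. by move=> Xp; rewrite -mulN1r; apply: in_idealM. Qed.

Lemma in_idealB n (X : generators K n) p q :
  in_ideal X p -> in_ideal X q -> in_ideal X (p - q).
Proof. by move=> Xp Xq; apply/in_idealD/in_idealN. Qed.

Lemma in_ideal_sum n (X : generators K n) I (r : seq I) (P : pred I)
    (c p : I -> {mpoly K[n]}) :
  (forall i, P i -> in_ideal X (p i)) ->
  in_ideal X (\sum_(i <- r | P i) c i * p i).
Proof.
move=> Xp; apply: big_ind => [|q1 q2|i Pi]; first exact: in_ideal0.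
- exact: in_idealD.
- exact/in_idealM/Xp.
Qed.

Lemma in_ideal_meval n (X : generators K n) v p :
  on X v -> in_ideal X p -> p.@[v] = 0.
Proof.
move=> [_ Xv] [s Xs ->]; rewrite raddf_sum big1_seq //= => cg /Xs /Xv v0.
by rewrite mevalM v0 mulr0.
Qed.

Lemma in_ideal_comp n m (X : generators K n) (Z : generators K m)
    (G : n.-tuple {mpoly K[m]}) p :
    (forall q, X q -> in_ideal Z (q \mPo G)) ->
  in_ideal X p -> in_ideal Z (p \mPo G).
Proof.
move=> XZ [s Xs ->]; rewrite raddf_sum big_seq_cond /=.
under eq_bigr do rewrite comp_mpolyM.
by apply: in_ideal_sum => cg; rewrite andbT => /Xs/XZ.
Qed.

(** Congruence modulo an ideal is compatible with sums and products. This serves to replace a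
    composite of linear maps by the identity modulo the ideal. *)
Lemma in_ideal_compB n m (Z : generators K m) (F G : n.-tuple {mpoly K[m]}) p :
    (forall i, in_ideal Z (tnth F i - tnth G i)) ->
  in_ideal Z ((p \mPo F) - (p \mPo G)).
Proof.
move=> ZFG; elim/mpoly_ringind: p => [c|i|p q IHp IHq|p q IHp IHq].
- by rewrite !comp_mpolyC subrr; apply: in_ideal0.
- by rewrite !comp_mpolyXU_tnth.
- rewrite !comp_mpolyD.
  move: (p \mPo F) (p \mPo G) (q \mPo F) (q \mPo G) IHp IHq => p1 p2 q1 q2 Zp Zq.
  by rewrite opprD addrACA; apply: in_idealD.
rewrite !comp_mpolyM.
move: (p \mPo F) (p \mPo G) (q \mPo F) (q \mPo G) IHp IHq => p1 p2 q1 q2 Zp Zq.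
have -> : p1 * q1 - p2 * q2 = q1 * (p1 - p2) + p2 * (q1 - q2) by ring.
by apply: in_idealD; apply: in_idealM.
Qed.

(** In the binomial expansion of [(g + h) ^+ (N + M)] every term contains [g ^+ N] or [h ^+ M]. *)
Lemma in_ideal_expD n (X : generators K n) g h q :
    (exists N, in_ideal X (g ^+ N * q)) -> (exists N, in_ideal X (h ^+ N * q)) ->
  exists N, in_ideal X ((g + h) ^+ N * q).
Proof.
move=> [N XN] [M XM]; exists (N + M)%N; rewrite exprDn mulr_suml.
apply: big_ind => [|q1 q2|i _]; first exact: in_ideal0.
- exact: in_idealD.
rewrite -mulr_natr; case: (leqP M i) => [leMi | ltiM].
- rewrite -[i in h ^+ i](subnK leMi) exprD.
  set u := g ^+ _; set v := h ^+ (i - M).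
  suff -> : u * (v * h ^+ M) * 'C(N + M, i)%:R * q
      = (u * v * 'C(N + M, i)%:R) * (h ^+ M * q) by apply: in_idealM.
  by ring.
- have leN : (N <= N + M - i)%N by rewrite -addnBA ?leq_addr // ltnW.
  rewrite -(subnK leN) exprD.
  set u := g ^+ (_ - _); set v := h ^+ i.
  suff -> : u * g ^+ N * v * 'C(N + M, i)%:R * q
      = (u * v * 'C(N + M, i)%:R) * (g ^+ N * q) by apply: in_idealM.
  by ring.
Qed.

Lemma in_ideal_exp_sum n (X : generators K n) I (r : seq I)
    (c g : I -> {mpoly K[n]}) q :
    (forall i, exists N, in_ideal X (g i ^+ N * q)) ->
  exists N, in_ideal X ((\sum_(i <- r) c i * g i) ^+ N * q).
Proof.
move=> Xg.
apply: (big_ind (fun h => exists N, in_ideal X (h ^+ N * q))) => [|h1 h2|i _].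
- by exists 1%N; rewrite expr1 mul0r; apply: in_ideal0.
- exact: in_ideal_expD.
- have [N XN] := Xg i; exists N.
  by rewrite exprMn -mulrA; apply: in_idealM.
Qed.

End Ideals.

(** * Morphisms given by linear forms *)

Section LinearMaps.
Variable K : fieldType.

(** The map [p |-> p *m A] on row vectors; composites then multiply matrices in the order in which
    the maps are applied. *)
Definition linear_tuple n m (A : 'M[K]_(n, m)) : m.-tuple {mpoly K[n]} :=
  [tuple \sum_i (A i k)%:MP * 'X_i | k < m].

Lemma tnth_linear_tuple n m (A : 'M[K]_(n, m)) k :
  tnth (linear_tuple A) k = \sum_i (A i k)%:MP * 'X_i.
Proof. by rewrite tnth_mktuple. Qed.

Lemma linear_tuple1 n i : tnth (linear_tuple (1%:M : 'M[K]_n)) i = 'X_i.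
Proof.
rewrite tnth_linear_tuple (bigD1 i) //= big1 => [|j ji].
  by rewrite mxE eqxx mpolyC1 mul1r addr0.
by rewrite mxE (negbTE ji) mpolyC0 mul0r.
Qed.

Lemma comp_linear_tuple n m l (A : 'M[K]_(n, m)) (B : 'M[K]_(m, l)) k :
  tnth (linear_tuple B) k \mPo linear_tuple A = tnth (linear_tuple (A *m B)) k.
Proof.
rewrite !tnth_linear_tuple raddf_sum /=.
under eq_bigr => j _.
  rewrite comp_mpolyM comp_mpolyC comp_mpolyXU_tnth tnth_linear_tuple mulr_sumr.
  over.
rewrite exchange_big /=; apply: eq_bigr => i _.
rewrite mxE raddf_sum mulr_suml; apply: eq_bigr => j _.
by rewrite /= mpolyCM mulrA [(B _ _)%:MP * _]mulrC.
Qed.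

Lemma linear_tuple_homog n m (A : 'M[K]_(n, m)) k :
  tnth (linear_tuple A) k \is 1.-homog.
Proof.
rewrite tnth_linear_tuple; apply: rpred_sum => i _.
by rewrite mul_mpolyC rpredZ // dhomogX /= mdeg1.
Qed.

Lemma zero_on0 n (X : generators K n) h : zero_on X h 0.
Proof. by move=> k; exists 0%N; rewrite mulr0; apply: in_ideal0. Qed.

Lemma in_ideal_zero_on n (X : generators K n) h p :
  in_ideal X p -> zero_on X h p.
Proof. by move=> Xp k; exists 0%N; rewrite expr0 mul1r. Qed.

Lemma linear_is_morphism n m (X : generators K n)
    (A : 'M[K]_(n, m)) (B : 'M[K]_(m, n)) :
    (forall i, in_ideal X (tnth (linear_tuple (A *m B)) i - 'X_i)) ->
  is_morphism X [:: linear_tuple A].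
Proof.
move=> AB1; split=> [F|p Xp|F G].
- by rewrite inE => /eqP->; exists 1%N => i; apply: linear_tuple_homog.
- exists (linear_tuple A); first exact: mem_head.
  case: (pickP (fun k => value (linear_tuple A) p k != 0)) => [k ?|Fp0].
    by exists k.
  (* If all forms of [A] vanished at [p], so would those of [A *m B], which agree with the
     coordinates on [X]; but some coordinate of [p] is nonzero. *)
  have [[i pi_neq0] _] := Xp; case/eqP: pi_neq0.
  have /eqP := in_ideal_meval Xp (AB1 i).
  rewrite mevalB mevalXU subr_eq0 => /eqP <-.
  rewrite -comp_linear_tuple comp_mpoly_meval tnth_linear_tuple raddf_sum.
  apply: big1 => k _; have /negbFE/eqP Fpk0 := Fp0 k.
  by rewrite /= mevalM mevalXU -/(value _ _ _) Fpk0 mulr0.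
- rewrite !inE => /eqP-> /eqP-> k l i j; rewrite [X in _ - X]mulrC subrr.
  exact: zero_on0.
Qed.

Lemma linear_same_morphism n m (X : generators K n)
    (A : 'M[K]_(n, m)) (B : 'M[K]_(m, n)) :
    (forall i, in_ideal X (tnth (linear_tuple (A *m B)) i - 'X_i)) ->
  same_morphism X (comp_morphism [:: linear_tuple B] [:: linear_tuple A])
                  (id_morphism K n).
Proof.
move=> AB1 F G; rewrite !inE => /eqP-> /eqP-> k l i j.
rewrite !tnth_comp_mpoly !comp_linear_tuple !(tnth_mktuple (fun i => 'X_i)).
apply: in_ideal_zero_on.
move: (tnth _ i) (tnth _ j) (AB1 i) (AB1 j) => Fi Fj XFi XFj.
have -> : Fi * 'X_j - Fj * 'X_i = 'X_j * (Fi - 'X_i) + (- 'X_i) * (Fj - 'X_j).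
  by ring.
by apply: in_idealD; apply: in_idealM.
Qed.

(** * Mutually inverse linear maps between two subschemes *)

Section LinearIsomorphism.
Variables (n m : nat) (X : generators K n) (Z : generators K m).
Variables (A : 'M[K]_(n, m)) (B : 'M[K]_(m, n)).
Hypothesis AB1 : A *m B = 1%:M.
Hypothesis BA1 : forall k, in_ideal Z (tnth (linear_tuple (B *m A)) k - 'X_k).
Hypothesis ZX : forall q, Z q -> in_ideal X (q \mPo linear_tuple A).
Hypothesis XZ : forall p, X p -> in_ideal Z (p \mPo linear_tuple B).

Let AB_id i : in_ideal X (tnth (linear_tuple (A *m B)) i - 'X_i).
Proof. by rewrite AB1 linear_tuple1 subrr; apply: in_ideal0. Qed.

Lemma linear_isomorphism_onto : isomorphism_onto X [:: linear_tuple A] Z.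
Proof.
split; first exact: linear_is_morphism AB_id.
  by move=> q Zq F; rewrite inE => /eqP-> k; apply/in_ideal_zero_on/ZX.
exists [:: linear_tuple B]; split; try exact: linear_same_morphism.
  exact: linear_is_morphism BA1.
by move=> p Xp F; rewrite inE => /eqP-> k; apply/in_ideal_zero_on/XZ.
Qed.

(** Since [B *m A] is the identity modulo the ideal of [Z], pulling [q] back along [A] and then
    along [B] changes it only by an element of that ideal. *)
Lemma in_ideal_comp_linear q :
  in_ideal X (q \mPo linear_tuple A) -> in_ideal Z q.
Proof.
move=> /(in_ideal_comp XZ) ZqAB.
rewrite -[q](subKr ((q \mPo linear_tuple A) \mPo linear_tuple B)).
apply: in_idealB => //; rewrite comp_mpolyA -{2}[q]comp_mpoly_id.
apply: in_ideal_compB => k.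
by rewrite tnth_comp_mpoly comp_linear_tuple (tnth_mktuple (fun i => 'X_i)).
Qed.

Lemma linear_scheme_image : scheme_image X [:: linear_tuple A] Z.
Proof.
move=> d q _; split=> [Xq l|Zq F]; last first.
  rewrite inE => /eqP-> k j; have [N ZN] := Zq k; exists N.
  have := in_ideal_comp ZX ZN; rewrite comp_mpolyM rmorphXn /= mul1r.
  rewrite comp_mpolyXU_tnth exprMn mulrAC => ?.
  by rewrite mulrC; apply: in_idealM.
(* As [A *m B] is the identity, ['X_l] times the [j]-th form of [B] pulls back to the [l]-th form of
   [A] times ['X_j], a power of which kills the pullback of [q] on [X]. *)
have ZlG j : exists N, in_ideal Z (('X_l * tnth (linear_tuple B) j) ^+ N * q).
  have [N XN] := Xq _ (mem_head _ _) l j; exists N.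
  apply: in_ideal_comp_linear; rewrite comp_mpolyM rmorphXn /= comp_mpolyM.
  by rewrite comp_mpolyXU_tnth comp_linear_tuple AB1 linear_tuple1.
have [N ZN] := in_ideal_exp_sum (index_enum _) (fun j => (A j l)%:MP) ZlG.
(* The combination of the forms of [B] with coefficients [A j l] pulls back to the [l]-th form of
   [A], as ['X_l] does. The [N]-th power of its product with ['X_l] thus has the same pullback as
   ['X_l ^+ (N + N)]. *)
exists (N + N)%N; apply: in_ideal_comp_linear.
have := in_ideal_comp ZX ZN.
rewrite !comp_mpolyM !rmorphXn /= raddf_sum mul1r /= comp_mpolyXU_tnth.
under eq_bigr => j _ do rewrite !comp_mpolyM comp_mpolyC comp_linear_tuple
  comp_mpolyXU_tnth AB1 linear_tuple1 mulrCA.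
by rewrite -mulr_sumr -tnth_linear_tuple exprMn exprD.
Qed.

End LinearIsomorphism.

(** * Parametrization of a linear section *)

Section LinearSection.
Variables (n m : nat) (X : generators K n) (Q : generators K m).
Variables (T : 'M[K]_n) (L : 'M[K]_(n, m)).
Hypotheses (T_unit : T \in unitmx) (L_free : row_free L).
Hypothesis QX : forall q, Q q -> in_ideal X (q \mPo linear_tuple (T *m L)).
Hypothesis XQ : forall p, X p ->
  in_ideal (fun p' => exists2 q, Q q & p' = q \mPo linear_tuple (T *m L)) p.

Let Z := intersection (linear_subspace L) Q.

Let section_inverse : exists B : 'M[K]_(m, n),
  [/\ T *m L *m B = 1%:M,
      forall k, in_ideal Z (tnth (linear_tuple (B *m (T *m L))) k - 'X_k),
      forall q, Z q -> in_ideal X (q \mPo linear_tuple (T *m L))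
    & forall p, X p -> in_ideal Z (p \mPo linear_tuple B)].
Proof.
have [B TLB] : exists B : 'M_(m, n), T *m L *m B = 1%:M.
  have [D LD1] := row_freeP L_free; exists (D *m invmx T).
  by rewrite mulmxA -(mulmxA T) LD1 mulmx1 mulmxV.
have BA1 k : in_ideal Z (tnth (linear_tuple (B *m (T *m L))) k - 'X_k).
  (* [B *m (T *m L)] projects onto the row space of [L], so each column of its difference with the
     identity is a linear form vanishing on [L]. *)
  apply: in_ideal_gen; left; exists (col k (B *m (T *m L) - 1%:M))^T.
    rewrite trmxK colE mulmxA mulmxBr mulmx1.
    have -> : L *m (B *m (T *m L)) = L.
      by apply: (can_inj (mulKmx T_unit)); rewrite !mulmxA TLB mul1mx.
    by rewrite subrr mul0mx.
  rewrite -linear_tuple1 !tnth_linear_tuple -sumrB; apply: eq_bigr => i _.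
  by rewrite -mulrBl !mxE mpolyCB.
have ZX q : Z q -> in_ideal X (q \mPo linear_tuple (T *m L)).
  case=> [[a La0 ->]|/QX//].
  have -> : \sum_i (a 0 i)%:MP * 'X_i = tnth (linear_tuple a^T) 0.
    by rewrite tnth_linear_tuple; apply: eq_bigr => k _; rewrite mxE.
  rewrite comp_linear_tuple -mulmxA La0 mulmx0 tnth_linear_tuple big1.
    exact: in_ideal0.
  by move=> k _; rewrite mxE mpolyC0 mul0r.
exists B; split=> // p /XQ; apply: in_ideal_comp => _ [q Qq ->].
(* Pulling [q] back to [X] and then along [B] changes it only modulo the linear forms vanishing on
   [L], and [q] itself is an equation of [Z]. *)
rewrite -[_ \mPo _](subrK q).
apply: in_idealD; last by apply: in_ideal_gen; right.
rewrite comp_mpolyA -{2}[q]comp_mpoly_id; apply: in_ideal_compB => k.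
by rewrite tnth_comp_mpoly comp_linear_tuple (tnth_mktuple (fun i => 'X_i)).
Qed.

Lemma linear_section_isomorphism_onto :
  isomorphism_onto X [:: linear_tuple (T *m L)] Z.
Proof.
by have [B []] := section_inverse; apply: linear_isomorphism_onto.
Qed.

Lemma linear_section_scheme_image :
  scheme_image X [:: linear_tuple (T *m L)] Z.
Proof.
by have [B []] := section_inverse; apply: linear_scheme_image.
Qed.

End LinearSection.
End LinearMaps.

(** * Subsets of ['I_5] as bit sequences *)

Lemma big_ord_inord (R : Type) (idx : R) (op : R -> R -> R) n (F : 'I_n.+1 -> R) :
  \big[op/idx]_(i < n.+1) F i = \big[op/idx]_(0 <= i < n.+1) F (inord i).
Proof.
by rewrite big_mkord; apply: eq_bigr => i _; rewrite inord_val.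
Qed.

Lemma eq_inord n i j : (i < n.+1)%N -> (j < n.+1)%N ->
  (inord i == inord j :> 'I_n.+1) = (i == j).
Proof. by move=> lti ltj; rewrite -val_eqE /= !inordK. Qed.

(** Finite sets do not reduce; on bit sequences the signs, wedging and contraction compute in each
    of the 32 cases. *)
Definition bits (I : {set 'I_5}) : bitseq := [seq inord i \in I | i <- iota 0 5].

Lemma nth_bits I i : (i < 5)%N -> nth false (bits I) i = (inord i \in I).
Proof. by move=> lti; rewrite (nth_map 0) ?size_iota // nth_iota. Qed.

Lemma bits_inj : injective bits.
Proof.
move=> I J eqIJ; apply/setP => i.
by rewrite -(inord_val i) -!nth_bits ?eqIJ.
Qed.

Lemma bits_cons I : exists b0 b1 b2 b3 b4, bits I = [:: b0; b1; b2; b3; b4].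
Proof. by do 5!eexists; reflexivity. Qed.

Lemma bitsD1 I i : (i < 5)%N ->
  bits (I :\ inord i) = set_nth false (bits I) i false.
Proof.
move=> lti; apply: (@eq_from_nth _ false) => [|j].
  by rewrite size_set_nth !size_map size_iota (maxn_idPr _).
rewrite size_map size_iota => ltj.
by rewrite nth_set_nth /= !nth_bits // !inE eq_inord //; case: eqP.
Qed.

Lemma bitsU1 I i : (i < 5)%N ->
  bits (inord i |: I) = set_nth false (bits I) i true.
Proof.
move=> lti; apply: (@eq_from_nth _ false) => [|j].
  by rewrite size_set_nth !size_map size_iota (maxn_idPr _).
rewrite size_map size_iota => ltj.
by rewrite nth_set_nth /= !nth_bits // !inE eq_inord //; case: eqP.
Qed.

Lemma bits_even_set k : (k < 16)%N ->
  bits (even_set (inord k)) = [seq i.+1 \in nth [::] even_sets k | i <- iota 0 5].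
Proof.
move=> ltk; apply/eq_in_map => i; rewrite mem_iota /= => lti.
by rewrite !inE !inordK.
Qed.

Local Notation "X @[ i ; .. ; j ]" := (X (i%N :: .. [:: j%N] ..))
  (at level 10, i at level 99, j at level 99).
Local Notation "X @[::]" := (X [::]) (at level 10).

(** * The quadratic map from half spinors to [V] *)

Section SpinorBil.
Variable R : comNzRingType.
Implicit Types X Z : seq nat -> R.

(* The equations of OG(5,10) as quadratic forms [spinor_bil x x], in an order and
   with signs that make them the coordinates of an equivariant map S^+ -> V. *)
Definition spinor_bil X Z : seq R :=
  [:: - (X @[::] * Z @[2; 3; 4; 5]) + X @[2; 3] * Z @[4; 5]
        - X @[2; 4] * Z @[3; 5] + X @[2; 5] * Z @[3; 4];
      X @[::] * Z @[1; 3; 4; 5] - X @[1; 3] * Z @[4; 5]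
        + X @[1; 4] * Z @[3; 5] - X @[1; 5] * Z @[3; 4];
      - (X @[::] * Z @[1; 2; 4; 5]) + X @[1; 2] * Z @[4; 5]
        - X @[1; 4] * Z @[2; 5] + X @[1; 5] * Z @[2; 4];
      X @[::] * Z @[1; 2; 3; 5] - X @[1; 2] * Z @[3; 5]
        + X @[1; 3] * Z @[2; 5] - X @[1; 5] * Z @[2; 3];
      - (X @[::] * Z @[1; 2; 3; 4]) + X @[1; 2] * Z @[3; 4]
        - X @[1; 3] * Z @[2; 4] + X @[1; 4] * Z @[2; 3];
      X @[1; 2] * Z @[1; 3; 4; 5] - X @[1; 3] * Z @[1; 2; 4; 5]
        + X @[1; 4] * Z @[1; 2; 3; 5] - X @[1; 5] * Z @[1; 2; 3; 4];
      X @[1; 2] * Z @[2; 3; 4; 5] - X @[2; 3] * Z @[1; 2; 4; 5]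
        + X @[2; 4] * Z @[1; 2; 3; 5] - X @[2; 5] * Z @[1; 2; 3; 4];
      X @[1; 3] * Z @[2; 3; 4; 5] - X @[2; 3] * Z @[1; 3; 4; 5]
        + X @[3; 4] * Z @[1; 2; 3; 5] - X @[3; 5] * Z @[1; 2; 3; 4];
      X @[1; 4] * Z @[2; 3; 4; 5] - X @[2; 4] * Z @[1; 3; 4; 5]
        + X @[3; 4] * Z @[1; 2; 4; 5] - X @[4; 5] * Z @[1; 2; 3; 4];
      X @[1; 5] * Z @[2; 3; 4; 5] - X @[2; 5] * Z @[1; 3; 4; 5]
        + X @[3; 5] * Z @[1; 2; 4; 5] - X @[4; 5] * Z @[1; 2; 3; 5]].

Lemma eq_spinor_bil X X' Z Z' :
    {in even_sets, X =1 X'} -> {in even_sets, Z =1 Z'} ->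
  spinor_bil X Z = spinor_bil X' Z'.
Proof. by move=> eqX eqZ; rewrite /spinor_bil !eqX // !eqZ. Qed.

End SpinorBil.

(** * The action of [V] on half spinors, and polarization *)

Section SpinorComputations.
Variable K : fieldType.
Implicit Types (x : 'I_16 -> K) (X Z : seq nat -> K).
Implicit Types (I : {set 'I_5}) (u : 'rV[K]_(5 + 5)).

(** The coefficient of e_I for the subset with bits [bs]; [mask] recovers the increasing list that
    labels its coordinate. *)
Definition spinor_bits X (bs : bitseq) : K :=
  if foldr addb false bs then 0 else X (mask bs [:: 1; 2; 3; 4; 5]%N).

Definition sgn_bits (bs : bitseq) i : K := (-1) ^+ foldr addb false (take i bs).

Lemma spinor_of_bits x I : spinor_of x I = spinor_bits (x \o even_idx) (bits I).
Proof.
rewrite ffunE big_mkcond big_ord_inord /=.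
under eq_big_nat => k /= ltk do rewrite -(inj_eq bits_inj) bits_even_set //.
rewrite /index_iota /= !big_cons big_nil.
by have [[] [[] [[] [[] [[] ->]]]]] := bits_cons I; rewrite /= ?addr0 ?add0r.
Qed.

Lemma sgnE i I : (i < 5)%N -> sgn K (inord i) I = sgn_bits (bits I) i.
Proof.
move=> lti; rewrite /sgn /sgn_bits; set c := #|_|.
have -> : foldr addb false (take i (bits I)) = odd c.
  rewrite /c -sum1dep_card big_mkcond big_ord_inord /=.
  under eq_big_nat => k /= ltk do rewrite !inordK //.
  rewrite /index_iota /= !big_cons big_nil /bits /=.
  case: i lti {c} => [|[|[|[|[|i]]]]] // _ /=;
    rewrite ?inE;
    by case: (inord 0 \in I); case: (inord 1 \in I); case: (inord 2 \in I);
      case: (inord 3 \in I); case: (inord 4 \in I).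
by rewrite signr_odd.
Qed.

Definition contract_bits X (bs : bitseq) i : K :=
  if nth false bs i then 0
  else sgn_bits bs i * spinor_bits X (set_nth false bs i true).

Definition wedge_bits X (bs : bitseq) i : K :=
  if nth false bs i then sgn_bits bs i * spinor_bits X (set_nth false bs i false)
  else 0.

Lemma phi_spinor_of u x I :
  phi u (spinor_of x) I = \sum_(0 <= i < 5)
    (u 0 (lshift 5 (inord i)) * contract_bits (x \o even_idx) (bits I) i
     + u 0 (rshift 5 (inord i)) * wedge_bits (x \o even_idx) (bits I) i).
Proof.
rewrite ffunE big_ord_inord; apply: eq_big_nat => i /= lti.
rewrite [contract _ _ _]ffunE [wedge _ _ _]ffunE.
by rewrite !spinor_of_bits bitsU1 // bitsD1 // sgnE // -nth_bits.
Qed.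

Lemma card_bits I : odd #|I| = foldr addb false (bits I).
Proof.
rewrite -sum1_card big_mkcond big_ord_inord /= /index_iota /= !big_cons big_nil.
by rewrite /bits /=; case: (inord 0 \in I); case: (inord 1 \in I);
  case: (inord 2 \in I); case: (inord 3 \in I); case: (inord 4 \in I).
Qed.

Lemma spinor_of_even x : even_part (spinor_of x).
Proof. by move=> I oddI; rewrite spinor_of_bits /spinor_bits -card_bits oddI. Qed.

Lemma spinor_of_neq0 x : nonzero x -> spinor_of x != 0.
Proof.
move=> [k xk_neq0]; apply: contra_neq xk_neq0 => /ffunP/(_ (even_set k)).
rewrite spinor_of_bits ffunE -(inord_val k) bits_even_set // inord_val.
by case: k => k ltk; do 16?[case: k ltk => [|k] ltk];
  rewrite // /spinor_bits /= => <-; congr x; apply: val_inj; rewrite /= inordK.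
Qed.

(** Bilinear but not symmetric: [spinor_row x x] is q(x), and the polar form B(x, z) is the sum of
    [spinor_row x z] and [spinor_row z x]. *)
Definition spinor_row x z : 'rV[K]_(5 + 5) :=
  \row_j nth 0 (spinor_bil (x \o even_idx) (z \o even_idx)) j.

Lemma spinor_row_l x z i : (i < 5)%N ->
  spinor_row x z 0 (lshift 5 (inord i))
    = nth 0 (spinor_bil (x \o even_idx) (z \o even_idx)) i.
Proof. by move=> lti; rewrite mxE /= inordK. Qed.

Lemma spinor_row_r x z i : (i < 5)%N ->
  spinor_row x z 0 (rshift 5 (inord i))
    = nth 0 (drop 5 (spinor_bil (x \o even_idx) (z \o even_idx))) i.
Proof. by move=> lti; rewrite mxE nth_drop /= inordK. Qed.

Let mxD (A B : 'rV[K]_(5 + 5)) j : (A + B) 0 j = A 0 j + B 0 j.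
Proof. by rewrite mxE. Qed.

(* Polarization of the identity [phi (spinor_row x x) (spinor_of x) = 0]. *)
Lemma phi_spinor_row x z :
  phi (spinor_row x z + spinor_row z x) (spinor_of x)
    + phi (spinor_row x x) (spinor_of z) = 0.
Proof.
apply/ffunP => I; rewrite [LHS]ffunE !phi_spinor_of -big_split big_nat.
under eq_bigr => i lti do rewrite ?mxD !spinor_row_l // !spinor_row_r //.
rewrite -big_nat; move: (x \o even_idx) (z \o even_idx) => X Z.
rewrite /index_iota /= !big_cons big_nil !ffunE.
have [[] [[] [[] [[] [[] ->]]]]] := bits_cons I;
  rewrite /contract_bits /wedge_bits /sgn_bits /spinor_bits /= ?expr0 ?expr1;
  ring.
Qed.

(** This is the coefficient of s^2 in the identity Q(q(x + s z)) = 0. It makes B(x, z) isotropic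
    whenever q(x) = 0. *)
Lemma quadform_spinor_row x z :
  let q v i := nth 0 (spinor_bil (v \o even_idx) (v \o even_idx)) i in
  quadform (spinor_row x z + spinor_row z x)
    = - \sum_(0 <= i < 5) (q x i * q z (i + 5)%N + q z i * q x (i + 5)%N).
Proof.
rewrite /= /quadform big_ord_inord big_nat.
under eq_bigr => i lti do rewrite ?mxD !spinor_row_l // !spinor_row_r //.
rewrite -big_nat; move: (x \o even_idx) (z \o even_idx) => X Z.
rewrite /index_iota /= !big_cons !big_nil /=.
ring.
Qed.

End SpinorComputations.

(** * Directional derivatives of polynomials *)

Section DirectionalDerivative.
Variables (K : fieldType) (n : nat) (p w : 'I_n -> K).
Implicit Types q r : {mpoly K[n]}.

(** For [q] among the [gquad] this is an entry of the row vector [w] times [Wperp p]; such values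
    are the coordinates of the vectors of W_p^perp. *)
Definition dirderiv q := \sum_i w i * q^`M(i).@[p].

Lemma dirderivD q r : dirderiv (q + r) = dirderiv q + dirderiv r.
Proof.
by rewrite -big_split; apply: eq_bigr => i _; rewrite mderivD mevalD mulrDr.
Qed.

Lemma dirderivN q : dirderiv (- q) = - dirderiv q.
Proof.
by rewrite -sumrN; apply: eq_bigr => i _; rewrite mderivN mevalN mulrN.
Qed.

Lemma dirderivM q r :
  dirderiv (q * r) = dirderiv q * r.@[p] + q.@[p] * dirderiv r.
Proof.
rewrite mulr_suml mulr_sumr -big_split; apply: eq_bigr => i _ /=.
by rewrite mderivM mevalD !mevalM mulrDr mulrA [q.@[p] * _]mulrCA.
Qed.

Lemma dirderivC c : dirderiv c%:MP = 0.
Proof. by apply: big1 => i _; rewrite mderivC meval0 mulr0. Qed.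

Lemma dirderivX i : dirderiv 'X_i = w i.
Proof.
rewrite /dirderiv (bigD1 i) //= big1 => [|j ji].
  rewrite mderivX mnm1E eqxx scale1r -[X in (X - _)%MM]add0m addmK.
  by rewrite mpolyX0 meval1 mulr1 addr0.
by rewrite mderivX mnm1E eq_sym (negbTE ji) scale0r meval0 mulr0.
Qed.

End DirectionalDerivative.

(** * The linear forms of the spinor map and the equations of the curve *)

Section SpinorForms.
Variables (S : comNzRingType) (a b : S) (Y : nat -> S).

(** The coordinates x_I of F, in the order of [even_sets]. A general ring [S] lets one formula stand
    for the linear forms and for their values at a point. *)
Definition spinor_forms (I : seq nat) : S :=
  nth 0 [:: - (a * b - b ^+ 2) * Y 3; b * Y 2; b * Y 2; 0; - (a - b) * Y 3;
            - b * Y 4; - b * Y 1; - b * Y 4; - b * (Y 0 + Y 3 - Y 4); - a * Y 3;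
            b * (Y 3 - Y 4); 0; - Y 5; 0; Y 6; 0] (index I even_sets).

End SpinorForms.

Section NodalCurve.
Variables (K : fieldType) (t0 t1 : K).

Lemma spinor_bil_forms :
  let X := spinor_forms t0%:MP t1%:MP (@y K) in
  spinor_bil X X = [seq t1%:MP * g | g <- gquad t0 t1].
Proof.
rewrite /= /spinor_bil /spinor_forms /gquad /=.
move: t0%:MP t1%:MP (y K 0) (y K 1) (y K 2) (y K 3) (y K 4) (y K 5) (y K 6).
move=> a b y0 y1 y2 y3 y4 y5 y6.
by congr [:: _; _; _; _; _; _; _; _; _; _]; ring.
Qed.

(** Differentiate q o F = t1 g at [p] along [w]: as F is linear, the left side becomes the polar
    form B(F(p), F(w)). *)
Lemma spinor_bil_dirderiv (p w : 'I_7 -> K) j : (j < 10)%N ->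
  let X := spinor_forms t0 t1 (fun i => p (inord i)) in
  let Z := spinor_forms t0 t1 (fun i => w (inord i)) in
  (spinor_bil X Z)`_j + (spinor_bil Z X)`_j
    = t1 * dirderiv p w (gquad t0 t1)`_j.
Proof.
do 10?[case: j => [_|j]] => //;
rewrite /= ?(expr2, dirderivD, dirderivN, dirderivM, dirderivC, dirderivX)
  ?(mevalD, mevalN, mevalM, mevalC, mevalXU) /spinor_forms /=.
all: ring.
Qed.

Lemma eq_even_idx I J : I \in even_sets -> J \in even_sets ->
  (even_idx I == even_idx J) = (I == J).
Proof.
move=> evI evJ; rewrite eq_inord ?index_mem //.
by apply/eqP/eqP => [/(congr1 (nth [::] even_sets))|->//]; rewrite !nth_index.
Qed.

Lemma evecE I J : I \in even_sets -> J \in even_sets ->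
  evec K I 0 (even_idx J) = (J == I)%:R.
Proof. by move=> evI evJ; rewrite mxE eqxx eq_even_idx. Qed.

(* Row [i] holds the coefficients of [y_i] in the coordinates of [spinor_forms]
   with respect to the rows of [Lnod]. *)
Definition coord_mx : 'M[K]_7 := \matrix_(i, j) nth 0 (nth [::]
  [:: [:: 0; 0; - t1; 0; 0; 0; 0];
      [:: 0; - t1; 0; 0; 0; 0; 0];
      [:: t1; 0; 0; 0; 0; 0; 0];
      [:: 0; 0; - t1; - 1; t1; 0; 0];
      [:: 0; 0; t1; 0; - t1; 0; 0];
      [:: 0; 0; 0; 0; 0; - 1; 0];
      [:: 0; 0; 0; 0; 0; 0; 1]] i) j.

Definition inv_coord_mx : 'M[K]_7 := \matrix_(i, j) nth 0 (nth [::]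
  [:: [:: 0; 0; t1^-1; 0; 0; 0; 0];
      [:: 0; - t1^-1; 0; 0; 0; 0; 0];
      [:: - t1^-1; 0; 0; 0; 0; 0; 0];
      [:: 0; 0; 0; - 1; - 1; 0; 0];
      [:: - t1^-1; 0; 0; 0; - t1^-1; 0; 0];
      [:: 0; 0; 0; 0; 0; - 1; 0];
      [:: 0; 0; 0; 0; 0; 0; 1]] i) j.

Lemma coord_mx_unit : t1 != 0 -> coord_mx \in unitmx.
Proof.
move=> t1_neq0; suff /mulmx1_unit[uT _] : coord_mx *m inv_coord_mx = 1%:M by [].
apply/matrixP => i j; rewrite -(inord_val i) -(inord_val j) !mxE eq_inord //.
rewrite big_ord_inord big_nat.
under eq_bigr => k ltk do rewrite !mxE !inordK //.
rewrite -big_nat /index_iota /= !big_cons big_nil.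
case: i => i lti; case: j => j ltj /=.
do 7?[case: i lti => [|i] lti] => //; do 7?[case: j ltj => [|j] ltj] => //=.
all: rewrite ?(mul0r, mulr0, addr0, add0r, mulr1, mul1r, mulrN, mulNr, opprK).
all: by rewrite // !mulfV // ?subrr // addrC subrr.
Qed.

Lemma LnodE i J : (i < 7)%N -> J \in even_sets ->
  Lnod t0 t1 (inord i) (even_idx J) = nth 0
    [:: (J == [:: 1; 2])%:R + (J == [:: 1; 3])%:R;
        (J == [:: 2; 4])%:R;
        (J == [:: 3; 4])%:R;
        (t0 * t1 - t1 ^+ 2) * (J == [::])%:R + (t0 - t1) * (J == [:: 1; 5])%:R
          + t1 * (J == [:: 2; 3])%:R + t1 * (J == [:: 2; 5])%:R
          + t0 * (J == [:: 3; 5])%:R;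
        (J == [:: 2; 3])%:R + (J == [:: 2; 5])%:R + (J == [:: 4; 5])%:R;
        (J == [:: 1; 2; 3; 5])%:R;
        (J == [:: 1; 3; 4; 5])%:R] i.
Proof.
move=> lti evJ; rewrite mxE inordK //.
have mxD (A B : 'rV[K]_16) j : (A + B) 0 j = A 0 j + B 0 j by rewrite mxE.
have mxZ c (A : 'rV[K]_16) j : (c *: A) 0 j = c * A 0 j by rewrite mxE.
have evE I : I \in even_sets -> evec K I 0 (even_idx J) = (J == I)%:R.
  by move=> evI; apply: evecE.
move: (evec K) (even_idx J) evE => ev k evE.
by do 7?[case: i lti => [|i] lti] => //=; rewrite ?(mxD, mxZ) !evE.
Qed.

Lemma tnth_coord_mx r : (r < 7)%N ->
  tnth (linear_tuple coord_mx) (inord r) = nth 0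
    [:: t1%:MP * y K 2; - t1%:MP * y K 1; - t1%:MP * (y K 0 + y K 3 - y K 4);
        - y K 3; t1%:MP * (y K 3 - y K 4); - y K 5; y K 6] r.
Proof.
move=> ltr; rewrite tnth_linear_tuple big_ord_inord big_nat.
under eq_bigr => k ltk do rewrite mxE !inordK // -/(y K k).
rewrite -big_nat /index_iota !big_cons big_nil.
move: (y K) => Y; do 7?[case: r ltr => [|r] ltr] => //=.
all: rewrite ?(mpolyC0, mpolyCN, mpolyC1); ring.
Qed.

Lemma tnth_spinor_forms J : J \in even_sets ->
  tnth (linear_tuple (coord_mx *m Lnod t0 t1)) (even_idx J)
    = spinor_forms t0%:MP t1%:MP (@y K) J.
Proof.
move=> evJ; rewrite -comp_linear_tuple tnth_linear_tuple raddf_sum /=.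
under eq_bigr => k _ do rewrite comp_mpolyM comp_mpolyC comp_mpolyXU_tnth.
rewrite big_ord_inord big_nat.
under eq_bigr => k ltk do rewrite LnodE // tnth_coord_mx //.
rewrite -big_nat /index_iota !big_cons big_nil /spinor_forms.
(* Writing [J] as the entry of [even_sets] at its position turns the goal into sixteen cases. *)
have := nth_index [::] evJ; have := evJ; rewrite -index_mem.
move: (index J _) (y K) => k Y ltk <- {J evJ}.
do 16?[case: k ltk => [|k] ltk] => //=.
all: rewrite ?(mpolyC0, mpolyCN, mpolyC1, mpolyCD, mpolyCM, mpolyCB, mpolyCX).
all: ring.
Qed.

Lemma Lnod_free : t0 != t1 -> row_free (Lnod t0 t1).
Proof.
move=> t0_neq_t1; apply/row_freeP.
(* Coordinate [J k] is nonzero in row [k] only, with value [t0 - t1] for [k = 3] and 1 otherwise;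
   selecting and rescaling these columns gives a right inverse. *)
pose J k := nth [::] [:: [:: 1; 2]; [:: 2; 4]; [:: 3; 4]; [:: 1; 5]; [:: 4; 5];
  [:: 1; 2; 3; 5]; [:: 1; 3; 4; 5]]%N k.
exists (\matrix_(k < 16, j < 7) ((k == even_idx (J j))%:R
  * (if j == inord 3 then (t0 - t1)^-1 else 1))).
apply/matrixP => i j; rewrite [LHS]mxE.
rewrite (bigD1 (even_idx (J j))) //= big1 => [|k /negbTE kJ]; last first.
  by rewrite mxE kJ mul0r mulr0.
have evJ : J j \in even_sets by case: j => j ltj; do 7?[case: j ltj => [|j] ltj].
rewrite [X in _ * X]mxE [RHS]mxE eqxx mul1r addr0.
rewrite -[X in Lnod _ _ X](inord_val i) LnodE //.
rewrite -(inord_val j) -val_eqE /= !inordK // {evJ}.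
case: i => i lti; case: j => j ltj /=.
do 7?[case: i lti => [|i] lti] => //; do 7?[case: j ltj => [|j] ltj] => //=.
all: rewrite ?(mul0r, mulr0, addr0, add0r, mulr1, mul1r) ?mulfV //.
all: by rewrite ?subr_eq0 // -val_eqE /= inordK.
Qed.

(* The rows give [t1 (t0 - t1)] times the equations [Cnod_eqs] in terms of
   [gquad]; conversely for [gquad_span]. *)
Definition Cnod_span : seq (seq K) :=
  let a := t0 in let b := t1 in let d := a - b in
  [:: [:: 0; 0; 0; 0; 0; b * d; 0; 0; 0; 0];
      [:: 0; 0; 0; 0; 0; 0; 0; 0; b * d; 0];
      [:: 0; 0; 0; 0; 0; 0; 0; 0; 0; b * d];
      [:: 0; 0; 0; 0; 0; 0; b * d; 0; 0; 0];
      [:: 0; 0; 0; 0; 0; 0; 0; b * d; 0; - (b * d)];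
      [:: d; 0; a; - b; 0; 0; 0; 0; 0; b * d];
      [:: 0; 0; 0; b * d; 0; 0; 0; 0; 0; - (b * d * d)];
      [:: 0; 0; b; - b; 0; 0; 0; 0; 0; b * d];
      [:: 0; - b; 0; - b; 0; 0; 0; 0; 0; b * d];
      [:: 0; 0; 0; 0; - d; 0; 0; 0; 0; 0]].

Definition gquad_span : seq (seq K) :=
  let a := t0 in let b := t1 in let d := a - b in
  [:: [:: 0; 0; 0; 0; 0; b; - 1; - a; 0; 0];
      [:: 0; 0; 0; 0; 0; 0; - 1; 0; - d; 0];
      [:: 0; 0; 0; 0; 0; 0; 1; d; 0; 0];
      [:: 0; 0; d; 0; 0; 0; 1; 0; 0; 0];
      [:: 0; 0; 0; 0; 0; 0; 0; 0; 0; - b];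
      [:: 1; 0; 0; 0; 0; 0; 0; 0; 0; 0];
      [:: 0; 0; 0; 1; 0; 0; 0; 0; 0; 0];
      [:: 0; 0; 1; 0; 1; 0; 0; 0; 0; 0];
      [:: 0; 1; 0; 0; 0; 0; 0; 0; 0; 0];
      [:: 0; 0; 1; 0; 0; 0; 0; 0; 0; 0]].

(** The factor [t1 * (t0 - t1)] clears denominators, so that the identity is polynomial in [t0] and
    [t1]. *)
Lemma Cnod_eqs_span k : (k < 10)%N ->
  (t1 * (t0 - t1))%:MP * (Cnod_eqs t0 t1)`_k
    = \sum_(0 <= j < 10) ((nth [::] Cnod_span k)`_j)%:MP * (gquad t0 t1)`_j.
Proof.
rewrite /index_iota !big_cons big_nil.
rewrite /gquad /Cnod_eqs /Cnod_span; move: (y K) => Y.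
do 10?[case: k => [_|k]] => //=.
all: rewrite ?(mpolyC0, mpolyCN, mpolyC1, mpolyCD, mpolyCM, mpolyCB).
all: move: (mpolyC 7 t0) (mpolyC 7 t1) => a b.
all: ring.
Qed.

Lemma gquad_spanE k : (k < 10)%N ->
  (gquad t0 t1)`_k
    = \sum_(0 <= j < 10) ((nth [::] gquad_span k)`_j)%:MP * (Cnod_eqs t0 t1)`_j.
Proof.
rewrite /index_iota !big_cons big_nil.
rewrite /gquad /Cnod_eqs /gquad_span; move: (y K) => Y.
do 10?[case: k => [_|k]] => //=.
all: rewrite ?(mpolyC0, mpolyCN, mpolyC1, mpolyCD, mpolyCM, mpolyCB).
all: move: (mpolyC 7 t0) (mpolyC 7 t1) => a b.
all: ring.
Qed.

End NodalCurve.

(** * Compatibility of the formulas with ring morphisms *)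

Section Morphisms.
Variables (R S : comNzRingType) (f : {rmorphism R -> S}).

Lemma rmorph_spinor_bil X Z :
  [seq f q | q <- spinor_bil X Z] = spinor_bil (f \o X) (f \o Z).
Proof.
by rewrite /spinor_bil /= !(rmorphD, rmorphB, rmorphN, rmorphM).
Qed.

Lemma rmorph_spinor_forms a b Y I :
  f (spinor_forms a b Y I) = spinor_forms (f a) (f b) (f \o Y) I.
Proof.
rewrite /spinor_forms; move: (index _ _) => k.
do 16?[case: k => [|k]];
  by rewrite /= ?nth_nil ?(rmorph0, rmorphN, rmorphM, rmorphD, rmorphB, rmorphXn).
Qed.

End Morphisms.

(** * The curve as a linear section of OG(5,10) *)

Section NodalSection.
Variables (K : fieldType) (t0 t1 : K).

Lemma OG_spinor_bil q : OG K q <-> exists2 j, (j < 10)%N &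
  q = (-1) ^+ ((j < 5)%N && ~~ odd j) * (spinor_bil (xvar K) (xvar K))`_j.
Proof.
rewrite /OG; move: (xvar K) => X; set s := (X in _ \in X).
split=> [/(nthP 0)[k ltk <-]|[j ltj ->]].
(* The equations of OG(5,10) come in pairs: one is, up to sign, among the first five components of
   q, the next is among the last five, where no sign occurs. *)
- exists (nth 0%N [:: 0; 5; 1; 6; 2; 7; 3; 8; 4; 9]%N k).
    by do 10?[case: k ltk => [|k] ltk].
  by rewrite /spinor_bil /s; do 10?[case: k ltk => [|k] ltk] => //=; ring.
- have -> : (-1) ^+ ((j < 5)%N && ~~ odd j) * (spinor_bil X X)`_j
      = s`_(nth 0%N [:: 0; 2; 4; 6; 8; 1; 3; 5; 7; 9]%N j).
    by rewrite /spinor_bil /s; do 10?[case: j ltj => [|j] ltj] => //=; ring.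
  by apply: mem_nth; do 10?[case: j ltj => [|j] ltj].
Qed.

Lemma OG_homogeneous : homogeneous (OG K).
Proof.
move=> q /OG_spinor_bil[j ltj ->]; exists (1 + 1)%N; rewrite rpredMsign.
have XX I J : xvar K I * xvar K J \is (1 + 1).-homog.
  by apply: dhomogM; rewrite dhomogX /= mdeg1.
move: (xvar K) XX => X XX; rewrite /spinor_bil.
by do 10?[case: j ltj => [|j] ltj] => //=; do !apply: rpredD; rewrite ?rpredN.
Qed.

Definition nodal_tuple := linear_tuple (coord_mx t1 *m Lnod t0 t1).

Lemma comp_spinor_bil j : (j < 10)%N ->
  (spinor_bil (xvar K) (xvar K))`_j \mPo nodal_tuple
    = t1%:MP * (gquad t0 t1)`_j.
Proof.
move=> ltj; rewrite -(nth_map 0 0 (fun g => t1%:MP * g)) // -spinor_bil_forms.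
rewrite -(nth_map 0 0 (comp_mpoly nodal_tuple)) //.
rewrite (rmorph_spinor_bil (comp_mpoly nodal_tuple)).
congr nth; apply: eq_spinor_bil => I evI /=;
  by rewrite comp_mpolyXU_tnth tnth_spinor_forms.
Qed.

Lemma value_nodal_tuple p I : I \in even_sets ->
  value nodal_tuple p (even_idx I)
    = spinor_forms t0 t1 (fun i => p (inord i)) I.
Proof.
move=> evI; rewrite /value tnth_spinor_forms // (rmorph_spinor_forms (meval p)) /=.
by rewrite !mevalC /spinor_forms /= /y !mevalXU.
Qed.

Lemma in_ideal_gquad j : (j < 10)%N -> in_ideal (Cnod t0 t1) (gquad t0 t1)`_j.
Proof.
move=> ltj; rewrite gquad_spanE // big_nat; apply: in_ideal_sum => k ltk.
by apply/in_ideal_gen/mem_nth.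
Qed.

Hypotheses (t0_neq_t1 : t0 != t1) (t1_neq0 : t1 != 0).

Lemma OG_in_ideal_Cnod q :
  OG K q -> in_ideal (Cnod t0 t1) (q \mPo nodal_tuple).
Proof.
move=> /OG_spinor_bil[j ltj ->]; rewrite comp_mpolyM comp_spinor_bil //.
by do 2!apply: in_idealM; apply: in_ideal_gquad.
Qed.

(** Here t is kept away from 1 and infinity: dividing by [t1 * (t0 - t1)] and by [t1] recovers the
    equations of the curve from the pulled back equations of OG(5,10). *)
Lemma Cnod_in_ideal_OG p : Cnod t0 t1 p ->
  in_ideal (fun p' => exists2 q, OG K q & p' = q \mPo nodal_tuple) p.
Proof.
move=> /(nthP 0)[k ltk <-]; set c := t1 * (t0 - t1).
have c_neq0 : c != 0 by rewrite mulf_neq0 // subr_eq0.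
rewrite -[_`_k]mul1r -mpolyC1 -(mulVf c_neq0) mpolyCM -mulrA Cnod_eqs_span //.
apply: in_idealM; rewrite big_nat; apply: in_ideal_sum => j ltj.
rewrite -[_`_j]mul1r -mpolyC1 -(mulVf t1_neq0) mpolyCM -mulrA.
rewrite -comp_spinor_bil //.
apply: in_idealM; rewrite -[_ \mPo _](signrMK ((j < 5)%N && ~~ odd j)).
apply: in_idealM; apply: in_ideal_gen.
exists ((-1) ^+ ((j < 5)%N && ~~ odd j) * (spinor_bil (xvar K) (xvar K))`_j).
  by apply/OG_spinor_bil; exists j.
by rewrite comp_mpolyM rmorphXn rmorphN1.
Qed.

End NodalSection.

(** * The half spinor at a smooth point *)

Section SpinorMap.
Variables (K : fieldType) (t0 t1 : K).
Hypotheses (t0_neq_t1 : t0 != t1) (t1_neq0 : t1 != 0).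

Definition jacobian n (s : seq {mpoly K[n]}) (p : 'I_n -> K) : 'M[K]_(10, n) :=
  \matrix_(k, i) (s`_k)^`M(i).@[p].

(** The relations have constant coefficients, so they persist between gradients: up to [c], one
    Jacobian is the coefficient matrix times the other. *)
Lemma rank_jacobian_le n (s r : seq {mpoly K[n]}) (C : seq (seq K)) (c : K)
    p :
    c != 0 ->
    (forall k, (k < 10)%N ->
       c%:MP * s`_k = \sum_(0 <= j < 10) ((nth [::] C k)`_j)%:MP * r`_j) ->
  (\rank (jacobian s p) <= \rank (jacobian r p))%N.
Proof.
move=> c_neq0 sr.
suff <- : (c^-1 *: \matrix_(k, j) (nth [::] C k)`_j) *m jacobian r p = jacobian s p.
  exact: mxrankM_maxr.
rewrite -scalemxAl; apply/matrixP => k i; rewrite !mxE.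
apply: (mulfI c_neq0); rewrite mulVKf //.
rewrite -[in RHS](mevalC p c) -mevalM -mderiv_mulC sr // big_mkord.
rewrite (raddf_sum (mderiv i)) (raddf_sum (meval p)); apply: eq_bigr => j _ /=.
by rewrite !mxE mderiv_mulC mevalM mevalC.
Qed.

(** The two systems of quadrics are combinations of each other, so their Jacobians have the same
    rank, and smoothness makes it 5. *)
Lemma rank_Wperp p : smooth_point t0 t1 p -> \rank (Wperp t0 t1 p) = 5%N.
Proof.
have -> : Wperp t0 t1 p = (jacobian (gquad t0 t1) p)^T.
  by apply/matrixP => i j; rewrite !mxE.
rewrite mxrank_tr => -[_ rkC]; apply/eqP; rewrite -[X in _ == X]rkC eqn_leq.
apply/andP; split; last first.
  apply: (@rank_jacobian_le _ _ _ (Cnod_span t0 t1) (t1 * (t0 - t1))).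
    by rewrite mulf_neq0 // subr_eq0.
  exact: Cnod_eqs_span.
apply: (@rank_jacobian_le _ _ _ (gquad_span t0 t1) 1); first exact: oner_neq0.
by move=> k ltk; rewrite mpolyC1 mul1r gquad_spanE.
Qed.

Lemma spinor_row_Wperp p (u : 'rV_(5 + 5)) : (u <= Wperp t0 t1 p)%MS ->
  exists z, let x := value (nodal_tuple t0 t1) p in
    t1 *: u = spinor_row x z + spinor_row z x.
Proof.
(* The combination of the rows with coefficients [w] is the derivative of g along [w], so [z] is
   F(w). *)
move=> /submxP[w ->]; exists (value (nodal_tuple t0 t1) (w 0)) => /=.
apply/rowP => j; rewrite !mxE.
have eqF v : {in even_sets, value (nodal_tuple t0 t1) v \o even_idx
    =1 spinor_forms t0 t1 (fun i => v (inord i))}.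
  by move=> I; apply: value_nodal_tuple.
rewrite !(eq_spinor_bil (eqF _) (eqF _)) spinor_bil_dirderiv //.
by congr (_ * _); apply: eq_bigr => i _; rewrite mxE.
Qed.

(** By q o F = t1 g, where g vanishes on the curve. *)
Lemma spinor_row_Cnod p : on (Cnod t0 t1) p ->
  let x := value (nodal_tuple t0 t1) p in spinor_row x x = 0.
Proof.
move=> Cp /=; apply/rowP => j; rewrite !mxE.
have : ((spinor_bil (xvar K) (xvar K))`_j \mPo nodal_tuple t0 t1).@[p] = 0.
  have gj0 := in_ideal_meval Cp (in_ideal_gquad t0 t1 (ltn_ord j)).
  by rewrite comp_spinor_bil // mevalM gj0 mulr0.
rewrite comp_mpoly_meval -(nth_map 0 0 (meval _)) // rmorph_spinor_bil.
move=> qj0; rewrite -[RHS]qj0; congr nth.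
by apply: eq_spinor_bil => I _; exact/esym/mevalXU.
Qed.

Lemma quadformZ c (u : 'rV[K]_(5 + 5)) : quadform (c *: u) = c ^+ 2 * quadform u.
Proof.
by rewrite mulr_sumr; apply: eq_bigr => i _; rewrite !mxE mulrACA.
Qed.

Lemma phiZ c (u : 'rV[K]_(5 + 5)) s I : phi (c *: u) s I = c * phi u s I.
Proof.
by rewrite !ffunE mulr_sumr; apply: eq_bigr => i _; rewrite !mxE mulrDr !mulrA.
Qed.

Lemma nodal_tuple_half_spinor p :
    smooth_point t0 t1 p -> nonzero (value (nodal_tuple t0 t1) p) ->
  half_spinor (Wperp t0 t1 p) (spinor_of (value (nodal_tuple t0 t1) p)).
Proof.
move=> p_smooth; have [Cp _] := p_smooth; have := spinor_row_Cnod Cp.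
set x := value _ p => /= xx0 x_neq0; split.
- split=> [|u uW]; first exact: rank_Wperp.
  (* [t1 *: u] is a polar vector B(x, z), isotropic because q(x) = 0; the nonzero scalar is then
     cancelled. *)
  have [z uE] := spinor_row_Wperp uW; have /eqP := quadform_spinor_row x z.
  have bil0 j : (j < 10)%N -> (spinor_bil (x \o even_idx) (x \o even_idx))`_j = 0.
    by move=> ltj; move/rowP/(_ (Ordinal ltj)): xx0; rewrite !mxE.
  rewrite -uE quadformZ big_nat big1 => [|j ltj].
    by rewrite oppr0 mulf_eq0 expf_eq0 (negbTE t1_neq0) => /eqP.
  have ltj5 : (j + 5 < 10)%N by rewrite (ltn_add2r 5 j 5).
  rewrite (bil0 (j + 5)%N) // bil0 ?(leq_ltn_trans (leq_addr 5 j)) //.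
  by rewrite mul0r mulr0 addr0.
- exact: spinor_of_even.
- exact: spinor_of_neq0.
move=> u uW; have [z uE] := spinor_row_Wperp uW.
apply/ffunP => I; have /ffunP/(_ I) := phi_spinor_row x z.
(* Writing the zero row as [0 *: 0] lets [phiZ] also clear the term with q(x) in the polarized
   identity; what is left is [t1] times the action of [u]. *)
rewrite xx0 -uE -(scale0r (0 : 'rV_(5 + 5))) ffunE !phiZ mul0r addr0 !ffunE.
by move=> /eqP; rewrite mulf_eq0 (negbTE t1_neq0) => /eqP.
Qed.

End SpinorMap.

Theorem proposition5p1 (R : realType) (t0 t1 : R[i])
    (t_neq1 : t0 <> t1) (t_neqoo : t1 <> 0) :
  \rank (Lnod t0 t1) = 7%N /\
  exists f : seq (16.-tuple {mpoly R[i][7]}),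
    [/\ is_morphism (Cnod t0 t1) f,
        extends_spinor_map t0 t1 f,
        closed_embedding (Cnod t0 t1) f
      & scheme_image (Cnod t0 t1) f
          (intersection (linear_subspace (Lnod t0 t1)) (OG R[i]))].
Proof.
have /eqP t0_neq_t1 := t_neq1; have /eqP t1_neq0 := t_neqoo.
have L_free := Lnod_free t0_neq_t1; have T_unit := coord_mx_unit t1_neq0.
have OGC := @OG_in_ideal_Cnod _ t0 t1.
have COG := Cnod_in_ideal_OG t0_neq_t1 t1_neq0.
have iso := linear_section_isomorphism_onto T_unit L_free OGC COG.
have img := linear_section_scheme_image T_unit L_free OGC COG.
split; first exact/eqP.
(* A single tuple suffices, since its linear forms have no common zero on the curve. *)
exists [:: nodal_tuple t0 t1]; split=> //.
- by have [] := iso.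
- move=> p p_smooth F; rewrite inE => /eqP->.
  exact: nodal_tuple_half_spinor.
(* The closed subscheme onto which the curve maps is the section itself, cut out by linear forms and
   quadrics. *)
- exists (intersection (linear_subspace (Lnod t0 t1)) (OG R[i])) => //.
  move=> q [[a _ ->]|].
    exists 1%N; apply: rpred_sum => i _.
    by rewrite mul_mpolyC rpredZ // dhomogX /= mdeg1.
  exact: OG_homogeneous.
Qed.
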